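(* Let $\mathcal{A}$ be a complex Banach algebra with unity, $c\in\mathcal{A}$, and $M=\begin{pmatrix}1&1\\ c&0\end{pmatrix}\in M_{2}(\mathcal{A})$. Then $c\in\mathcal{A}^{qnil}$ if and only if $M$ is g-Hirano invertible in $M_{2}(\mathcal{A})$.
   Context: $M_{2}(\mathcal{A})$ is the Banach algebra of $2\times2$ matrices over $\mathcal{A}$. For a unital Banach algebra $\mathcal{B}$, $\mathcal{B}^{qnil}$ is the set of elements with spectrum $\{0\}$. An element $a\in\mathcal{B}$ is g-Hirano invertible if there exists $x\in\mathcal{B}$ with $xax=x$, $ax=xa$ and $a^{2}-ax\in\mathcal{B}^{qnil}$. *)

(* Defs.v *)
From HB Require Import structures.
From mathcomp Require Import all_boot all_order all_algebra.
From mathcomp Require Import all_classical all_reals.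
From mathcomp Require Import complex.
Set Implicit Arguments. Unset Strict Implicit. Unset Printing Implicit Defensive.
Import Order.TTheory GRing.Theory Num.Theory ComplexField.
Local Open Scope ring_scope.

Definition cauchy_seq (R : realType) (A : zmodType) (nrm : A -> R)
    (u : nat -> A) : Prop :=
  forall e : R, 0 < e -> exists N : nat, forall m n : nat,
    (N <= m)%N -> (N <= n)%N -> nrm (u m - u n) < e.

Definition converges_to (R : realType) (A : zmodType) (nrm : A -> R)
    (u : nat -> A) (l : A) : Prop :=
  forall e : R, 0 < e -> exists N : nat, forall n : nat,
    (N <= n)%N -> nrm (u n - l) < e.

Definition is_banach_algebra_norm (R : realType) (A : algType R[i])
    (nrm : A -> R) : Prop :=
  [/\ (forall x : A, nrm x = 0 -> x = 0),
      (forall x y : A, nrm (x + y) <= nrm x + nrm y),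
      (forall (k : R[i]) (x : A), nrm (k *: x) = Normc.normc k * nrm x),
      (forall x y : A, nrm (x * y) <= nrm x * nrm y) &
      (forall u : nat -> A, cauchy_seq nrm u ->
         exists l : A, converges_to nrm u l)].

(* Spectral notions (purely algebraic, relative to a unital ring T and the *)
(* embedding scal : K -> T, lambda |-> lambda * 1 of the scalars).         *)

Definition invertible (T : nzRingType) (a : T) : Prop :=
  exists b : T, a * b = 1 /\ b * a = 1.

Definition spectrum (K : nzRingType) (T : nzRingType) (scal : K -> T) (a : T)
  : set K := [set l | ~ invertible (scal l - a)].

Definition qnil (K : nzRingType) (T : nzRingType) (scal : K -> T) (a : T)
  : Prop := spectrum scal a = [set 0]%classic.

Definition gHirano (K : nzRingType) (T : nzRingType) (scal : K -> T) (a : T)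
  : Prop :=
  exists x : T, x * a * x = x /\ a * x = x * a /\ qnil scal (a ^+ 2 - a * x).

Definition scalA (K : nzRingType) (A : lalgType K) (l : K) : A := l%:A.
Definition scalM2 (K : nzRingType) (A : lalgType K) (l : K) : 'M[A]_2 :=
  (l%:A)%:M.

Definition mx2 (T : Type) (a b c d : T) : 'M[T]_2 :=
  \matrix_(i < 2, j < 2)
    if i == 0 :> nat then (if j == 0 :> nat then a else b)
    else (if j == 0 :> nat then c else d).

(* Main.v *)
(* Everything rests on the identity M^2 = M + c.

   If M has a g-Hirano inverse x, then M^2 is the sum of the idempotent p = M x
   and a commuting quasinilpotent, so the spectrum of M lies in {0, 1, -1}. A
   Schur complement shows that l is in the spectrum of M iff l^2 - l is in that
   of c; the spectrum of M is thus invariant under l -> 1 - l, which excludes -1.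

   Conversely, if c is quasinilpotent, then t^2 - t = c has a quasinilpotent
   solution t commuting with c, so that (M - (1 - t)) (M - t) = 0, and the
   spectral idempotent p = (M - t) (1 - 2 t)^-1 yields x = (1 - t)^-1 p. To
   produce t one needs that ||(8 c)^n|| <= 1 for some n >= 1. This case of the
   spectral radius formula is proved without contour integrals, following
   Rickart: the inverse of 1 - (z c)^n is the mean of the inverses of
   1 - w z c over the n-th roots of unity w, hence is Lipschitz in |z| uniformly
   in n, which lets one enlarge |z| by steps of constant size. Only n = 2^k is
   used. *)
Require Import Defs.
From HB Require Import structures.
From mathcomp Require Import all_boot all_order all_algebra.
From mathcomp Require Import all_classical all_reals.
From mathcomp Require Import topology normedtype.
From mathcomp Require Import complex ring lra.
Import Order.TTheory GRing.Theory Num.Theory ComplexField numFieldNormedType.Exports.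
Local Open Scope ring_scope.

Set Implicit Arguments.
Unset Strict Implicit.

(** * Invertible elements and idempotents *)

Section Invertible.
Variable T : nzRingType.
Implicit Types a b p x y : T.

Lemma left_right_invertible a x y : x * a = 1 -> a * y = 1 -> invertible a.
Proof.
move=> xa ay; have xy : x = y by rewrite -[x]mulr1 -ay mulrA xa mul1r.
by exists x; rewrite {1}xy.
Qed.

Lemma invertibleM a b : invertible a -> invertible b -> invertible (a * b).
Proof.
move=> [x [ax xa]] [y [b_y yb]]; exists (y * x); split.
  by rewrite mulrA -(mulrA a) b_y mulr1.
by rewrite mulrA -(mulrA y) xa mulr1.
Qed.

Lemma invertibleN a : invertible a -> invertible (- a).
Proof. by move=> [x [ax xa]]; exists (- x); rewrite !mulrNN. Qed.

Lemma comm_inverse a x y :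
  a * x = 1 -> x * a = 1 -> GRing.comm y a -> GRing.comm y x.
Proof.
move=> ax xa ya; rewrite /GRing.comm -[y * x]mul1r -xa.
by rewrite mulrA -(mulrA x a) -ya -!mulrA ax mulr1.
Qed.

Lemma invertible_comm_factor a b :
  GRing.comm a b -> invertible (a * b) -> invertible a.
Proof.
move=> ab [x [abx xab]]; apply: (@left_right_invertible _ (x * b) (b * x)).
  by rewrite -mulrA -ab.
by rewrite mulrA.
Qed.

(** Elements [a * p + b * (1 - p)] multiply componentwise, like pairs [(a, b)]. Only the entries of
    the right factor have to move past the idempotents. *)
Lemma peirce_mul p a b x y : p * p = p -> GRing.comm x p -> GRing.comm y p ->
  (a * p + b * (1 - p)) * (x * p + y * (1 - p)) = a * x * p + b * y * (1 - p).
Proof.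
move=> pp xp yp.
have pe : p * (1 - p) = 0 by rewrite mulrBr mulr1 pp subrr.
have ep : (1 - p) * p = 0 by rewrite mulrBl mul1r pp subrr.
have ee : (1 - p) * (1 - p) = 1 - p by rewrite mulrBr mulr1 ep subr0.
have ye : GRing.comm y (1 - p) by apply: commrB => //; exact: commr1.
have comp u v z f g : GRing.comm v f -> f * g = z -> u * f * (v * g) = u * v * z.
  by move=> vf <-; rewrite -mulrA (mulrA f) -vf !mulrA.
have xe : GRing.comm x (1 - p) by apply: commrB => //; exact: commr1.
move: (1 - p) pe ep ee ye xe => e pe ep ee ye xe.
rewrite mulrDl !mulrDr (comp _ _ _ _ _ _ xp pp) (comp _ _ _ _ _ _ yp pe).
by rewrite (comp _ _ _ _ _ _ xe ep) (comp _ _ _ _ _ _ ye ee) !mulr0 addr0 add0r.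
Qed.

Lemma sub_peirce p a b x :
  x - (a * p + b * (1 - p)) = (x - a) * p + (x - b) * (1 - p).
Proof.
have e1 : p + (1 - p) = 1 by rewrite addrC subrK.
move: (1 - p) e1 => e e1.
by rewrite !mulrBl addrACA -mulrDr e1 mulr1 opprD.
Qed.

Lemma invertible_peirce p a b : p * p = p -> GRing.comm a p -> GRing.comm b p ->
  invertible a -> invertible b -> invertible (a * p + b * (1 - p)).
Proof.
move=> pp ap bp [x [ax xa]] [y [b_y yb]].
have xp : GRing.comm x p by apply/commr_sym/(comm_inverse ax xa)/commr_sym.
have yp : GRing.comm y p by apply/commr_sym/(comm_inverse b_y yb)/commr_sym.
exists (x * p + y * (1 - p)).
by rewrite !peirce_mul// ax b_y xa yb !mul1r addrC subrK.
Qed.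

End Invertible.

(** * Quasinilpotent elements and g-Hirano inverses *)

Section Spectral.
Variables (K : numClosedFieldType) (T : nzRingType) (f : {rmorphism K -> T}).
Hypothesis f_central : forall l x, GRing.comm x (f l).
Implicit Types M t p x : T.

Lemma invertible_scal l : l != 0 -> invertible (f l).
Proof.
by move=> l0; exists (f l^-1); rewrite -!rmorphM mulfV// mulVf// rmorph1.
Qed.

Lemma qnil_invertible t l : qnil f t -> l != 0 -> invertible (f l - t).
Proof.
move=> qt /eqP l0; apply: contrapT => nl; apply: l0.
by have : spectrum f t l by []; rewrite qt.
Qed.

Lemma qnil_noninvertible t : qnil f t -> ~ invertible t.
Proof.
move=> qt /invertibleN.
have : spectrum f t 0 by rewrite qt.
by rewrite /spectrum /= rmorph0 sub0r.
Qed.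

Lemma qnilP t : ~ invertible t ->
  (forall l, l != 0 -> invertible (f l - t)) -> qnil f t.
Proof.
move=> nt it; apply/seteqP; split=> l /=.
  by move=> nl; apply/eqP/negPn/negP => /it.
by move=> -> /invertibleN; rewrite rmorph0 sub0r opprK.
Qed.

Lemma sqr_sub_factor M l : f (l ^+ 2) - M * M = (f l - M) * (f l + M).
Proof.
by rewrite expr2 rmorphM mulrBl !mulrDr (f_central l M) opprD addrA addrK.
Qed.

Lemma resolvent_of_sqr M l :
  invertible (f (l ^+ 2) - M * M) -> invertible (f l - M).
Proof.
rewrite sqr_sub_factor; apply: invertible_comm_factor.
apply/commr_sym/commrB; first exact: f_central.
by apply/commr_sym/commrD.
Qed.

Lemma resolvent_sqr M l : invertible (f l - M) -> invertible (f (- l) - M) ->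
  invertible (f (l ^+ 2) - M * M).
Proof.
move=> iM iNM; rewrite sqr_sub_factor; apply: invertibleM => //.
by rewrite -[_ + M]opprK opprD -rmorphN; apply: invertibleN.
Qed.

(** The argument factors as [(f l - t) * (f (l - 1) + t)], and the factors commute because scalars
    are central. *)
Lemma quadratic_resolvent t l : invertible (f (l ^+ 2 - l) - (t * t - t)) ->
  invertible (f l - t).
Proof.
have -> : f (l ^+ 2 - l) - (t * t - t) = (f l - t) * (f (l - 1) + t).
  rewrite !rmorphB rmorph1 expr2 rmorphM; move: (f l) (f_central l t) => x tx.
  rewrite mulrBl !mulrDr !mulrN !mulr1 tx.
  by rewrite -[x * t - t + _]addrA [- t + _]addrC [RHS]addrKA.
apply: invertible_comm_factor.
by apply/commr_sym/commrB; [exact: f_central | exact/commr_sym/commrD].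
Qed.

Lemma subr_peirce (a p : T) : a - p = (a - 1) * p + a * (1 - p).
Proof. by rewrite mulrBl mul1r mulrBr mulr1 [RHS]addrC addrA subrK. Qed.

Lemma commM_idem M x : M * x = x * M -> GRing.comm M (M * x).
Proof. by move=> Mx; rewrite /GRing.comm -mulrA Mx. Qed.

Lemma idem_mul M x : x * M * x = x -> M * x * (M * x) = M * x.
Proof. by move=> xMx; rewrite -mulrA (mulrA x) xMx. Qed.

(** With [p = M * x] and [q = M ^+ 2 - p], the element [f (l ^+ 2) - M ^+ 2] has Peirce components
    [f (l ^+ 2 - 1) - q] and [f (l ^+ 2) - q]. Both are invertible, since [l ^+ 2] is neither 1 nor
    0. *)
Lemma gHirano_resolvent M x l : x * M * x = x -> M * x = x * M ->
  qnil f (M ^+ 2 - M * x) -> l != 0 -> l != 1 -> l != -1 ->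
  invertible (f l - M).
Proof.
move=> xMx Mx qq l0 l1 lN1; apply: resolvent_of_sqr.
have := idem_mul xMx; have := commM_idem Mx; move: (M * x) qq => p qq Mp pp.
set q := M ^+ 2 - p in qq; pose a := f (l ^+ 2) - q.
have qp : GRing.comm q p.
  by apply/commr_sym/commrB => //; exact/commrX/commr_sym.
have ap : GRing.comm a p.
  by apply/commr_sym/commrB; [exact: f_central | exact: commr_sym].
have -> : f (l ^+ 2) - M * M = a - p.
  by rewrite /a /q expr2 opprB addrA addrAC addrK.
rewrite subr_peirce; apply: invertible_peirce => //.
- by apply/commr_sym/commrB; [exact: commr_sym | exact: commr1].
- rewrite /a addrAC -(rmorph1 f) -rmorphB.
  by apply: qnil_invertible => //; rewrite subr_eq0 sqrf_eq1 negb_or l1.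
- by apply: qnil_invertible => //; rewrite sqrf_eq0.
Qed.

(** A nonempty spectrum without Liouville's theorem: invertibility of [f l - M] at 0, 1 and -1 makes
    [M ^+ 2] and [M ^+ 2 - 1] invertible, hence also [M ^+ 2 - M * x], which is quasinilpotent. *)
Lemma gHirano_exists_spectrum M :
  gHirano f M -> ~ (forall l, invertible (f l - M)).
Proof.
move=> [x [xMx [Mx qq]]] iM; apply: (qnil_noninvertible qq).
have := idem_mul xMx; have := commM_idem Mx; move: (M * x) {qq} => p Mp pp.
have M2p : GRing.comm (M ^+ 2) p by apply/commr_sym/commrX/commr_sym.
rewrite subr_peirce; apply: invertible_peirce => //.
- by apply/commr_sym/commrB; [exact: commr_sym | exact: commr1].
- rewrite -(rmorph1 f) in iM *.
  have -> : M ^+ 2 - f 1 = (f 1 - M) * (f (-1) - M).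
    rewrite rmorphN rmorph1 mulrBl mul1r mulrBr mulrN1 opprB opprK.
    by rewrite [M * M + M]addrC addrA subrK addrC expr2.
  exact: invertibleM.
- have -> : M ^+ 2 = (f 0 - M) * (f 0 - M) by rewrite rmorph0 sub0r mulrNN expr2.
  exact: invertibleM.
Qed.

(* M equals s = 1 - t on the range of p = (M - t) (1 - 2 t)^-1 and equals t on
   its kernel. *)
Lemma gHirano_of_qnil_root M t : qnil f t -> GRing.comm M t ->
  (M - (1 - t)) * (M - t) = 0 -> gHirano f M.
Proof.
move=> qt Mt Mst; pose s := 1 - t; pose n := M - t.
have f1 : f 1 = 1 by rewrite rmorph1.
have st : GRing.comm s t.
  by apply/commr_sym/commrB; [exact: commr1 | exact: commr_refl].
have Ms : GRing.comm M s by apply: commrB => //; exact: commr1.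
have nt : GRing.comm n t.
  by apply: commr_sym; apply: commrB => //; exact: commr_sym.
have nM : GRing.comm n M by apply: commr_sym; exact: commrB.
have ns : GRing.comm n s by apply: commrB => //; exact: commr1.
have [w [sw ws]] : invertible s.
  by rewrite /s -f1; exact: (qnil_invertible qt (oner_neq0 _)).
have d2 : s - t = f 2 * (f 2^-1 - t).
  rewrite mulrBr -rmorphM mulfV ?pnatr_eq0// rmorph1 rmorph_nat mulr_natl mulr2n.
  by rewrite /s opprD addrA.
have [v [dv vd]] : invertible (s - t).
  rewrite d2; apply: invertibleM; first by apply: invertible_scal; rewrite pnatr_eq0.
  by apply: qnil_invertible => //; rewrite invr_eq0 pnatr_eq0.
have Mn : M * n = s * n.
  by apply/eqP; rewrite -subr_eq0 -mulrBl; apply/eqP.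
(* Hence [n] divided by [s - t] is idempotent. *)
have nn : n * n = (s - t) * n by rewrite {1}/n mulrBl Mn -mulrBl.
have comm_v y : GRing.comm y s -> GRing.comm y t -> GRing.comm y v.
  by move=> ys yt; apply: (comm_inverse dv vd); exact: commrB.
have vn := commr_sym (comm_v _ ns nt).
have vt := commr_sym (comm_v _ (commr_sym st) (commr_refl t)).
have vs := commr_sym (comm_v _ (commr_refl s) st).
have vM := commr_sym (comm_v _ Ms Mt).
pose p := v * n.
have comm_p y : GRing.comm v y -> GRing.comm n y -> GRing.comm p y.
  by move=> vy ny; apply/commr_sym/commrM; exact/commr_sym.
have pM := comm_p _ vM nM; have ps := comm_p _ vs ns; have pt := comm_p _ vt nt.
have pp : p * p = p.
  by rewrite /p mulrA -(mulrA v n v) -vn -!mulrA nn (mulrA v (s - t)) vd mul1r.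
have Mp : M * p = s * p by rewrite /p mulrA -vM -mulrA Mn mulrA vs mulrA.
have Mp' : M * (1 - p) = t * (1 - p).
  apply/eqP; rewrite -subr_eq0 -mulrBl mulrBr mulr1 /p mulrA -vn -mulrA nn.
  by rewrite mulrA vd mul1r subrr.
have pw : GRing.comm p w by apply: (comm_inverse sw ws).
have Mw : GRing.comm M w by apply: (comm_inverse sw ws).
have Mwp : M * (w * p) = p by rewrite mulrA Mw -mulrA Mp mulrA ws mul1r.
exists (w * p); rewrite Mwp; split; last split.
- by rewrite -[w * p * M * _]mulrA Mwp -mulrA pp.
- by rewrite -mulrA pM mulrA -Mw -mulrA Mwp.
have e1 : 1 = p + (1 - p) by rewrite addrC subrK.
have M2 : M ^+ 2 = s * s * p + t * t * (1 - p).
  rewrite expr2 -[LHS]mulr1 {1}e1 mulrDr -!(mulrA M) Mp Mp' !mulrA Ms Mt -!mulrA.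
  by rewrite Mp Mp'.
have -> : M ^+ 2 - p = (s * s - 1) * p + t * t * (1 - p).
  by rewrite M2 [(s * s - 1) * p]mulrBl mul1r addrAC.
apply: qnilP => [|l l0].
  (* Both Peirce components have a factor [t], so [t] divides [M ^+ 2 - p] with a commuting cofactor
     and would inherit its invertibility. *)
  have -> : s * s - 1 = t * (t - 1 - 1).
    rewrite /s mulrBl mul1r !mulrBr !mulr1 opprB [LHS]addrC !addrA.
    by rewrite addNr add0r [- t + _]addrC.
  rewrite -!mulrA -mulrDr => it; apply: (qnil_noninvertible qt).
  apply: invertible_comm_factor it.
  have tp : GRing.comm t p := commr_sym pt.
  have t1 := commr1 t.
  apply: commrD; apply: commrM => //; last by apply: commrB.
  by apply: commrB => //; apply: commrB.
have -> : f l - ((s * s - 1) * p + t * t * (1 - p))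
    = (f (l + 1) - s * s) * p + (f l - t * t) * (1 - p).
  have -> : f (l + 1) - s * s = f l - (s * s - 1).
    by rewrite rmorphD f1 opprB addrA.
  exact: sub_peirce.
have sq y z : GRing.comm p y -> GRing.comm (f z - y * y) p.
  by move=> py; apply/commr_sym/commrB; [exact: f_central | exact: commrM].
have inv_s z : z != 1 -> invertible (f z - s).
  move=> z1; have -> : f z - s = - (f (1 - z) - t).
    by rewrite rmorphB f1 /s !opprB addrCA.
  by apply/invertibleN/qnil_invertible => //; rewrite subr_eq0 eq_sym.
have sqrtN1 (z y : K) : z ^+ 2 = y -> y != 1 -> (z != 1) && (- z != 1).
  by move=> <-; rewrite sqrf_eq1 negb_or eqr_oppLR.
apply: invertible_peirce => //; try exact: sq.
(* The only spectral value of [s = 1 - t] is 1, and the square roots of [l + 1] avoid it because [l]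
   is nonzero. *)
- have /andP[] : (sqrtC (l + 1) != 1) && (- sqrtC (l + 1) != 1).
    by apply: (sqrtN1 _ _ (sqrtCK _)); rewrite -subr_eq0 addrK.
  by move=> /inv_s i1 /inv_s i2; rewrite -(sqrtCK (l + 1)); apply: resolvent_sqr.
- by rewrite -(sqrtCK l); apply: resolvent_sqr; apply: qnil_invertible;
    rewrite ?oppr_eq0 ?sqrtC_eq0.
Qed.
End Spectral.

(** * The matrix (1, 1; c, 0) *)

Section TwoByTwo.
Variables (K : numClosedFieldType) (A : algType K).
Implicit Types (a b c d : A) (N : 'M[A]_2).

Let scalM : {rmorphism K -> 'M[A]_2} := (@scalar_mx A 2 \o in_alg A)%FUN.
Let scal : {rmorphism K -> A} := in_alg A.

Lemma mx2E N : N = mx2 (N 0 0) (N 0 1) (N 1 0) (N 1 1).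
Proof.
apply/matrixP => i j; rewrite mxE.
by case: (unliftP 0 i) => [i'|] ->; case: (unliftP 0 j) => [j'|] ->;
  rewrite ?ord1 //=; congr (N _ _); apply: val_inj.
Qed.

Lemma mx2_inj a b c d a' b' c' d' : mx2 a b c d = mx2 a' b' c' d' ->
  [/\ a = a', b = b', c = c' & d = d'].
Proof.
move=> /matrixP e.
by move: (e 0 0) (e 0 1) (e 1 0) (e 1 1); rewrite !mxE.
Qed.

Lemma mx2_mul a b c d a' b' c' d' : mx2 a b c d * mx2 a' b' c' d' =
  mx2 (a * a' + b * c') (a * b' + b * d') (c * a' + d * c') (c * b' + d * d').
Proof. by rewrite [LHS]mx2E !mxE !big_ord_recl !big_ord0 !mxE /= !addr0. Qed.

Lemma mx2_sub a b c d a' b' c' d' : mx2 a b c d - mx2 a' b' c' d' =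
  mx2 (a - a') (b - b') (c - c') (d - d').
Proof. by rewrite [LHS]mx2E !mxE. Qed.

Lemma scalar_mx2 a : a%:M = mx2 a 0 0 a.
Proof. by rewrite [LHS]mx2E !mxE. Qed.

Lemma zero_mx2 : 0 = mx2 0 0 0 0 :> 'M[A]_2.
Proof. by rewrite [LHS]mx2E !mxE. Qed.

Lemma one_mx2 : 1 = mx2 1 0 0 1 :> 'M[A]_2.
Proof. exact: scalar_mx2. Qed.

Lemma scalM_mx2 l : scalM l = mx2 l%:A 0 0 l%:A.
Proof. exact: scalar_mx2. Qed.

Lemma invertible_scalar_mx2 a : invertible a <-> invertible (a%:M : 'M[A]_2).
Proof.
split=> [[b [ab ba]]|[N []]].
  by exists b%:M; rewrite -!rmorphM/= ab ba.
rewrite (mx2E N) scalar_mx2 !mx2_mul one_mx2.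
move=> /mx2_inj[e _ _ _] /mx2_inj[e' _ _ _]; exists (N 0 0).
by move: e e'; rewrite mul0r mulr0 !addr0.
Qed.

Lemma qnil_scalar_mx2 a : qnil scal a -> qnil scalM a%:M.
Proof.
move=> qa; apply: qnilP => [/invertible_scalar_mx2|l l0].
  exact: qnil_noninvertible qa.
by rewrite /= -rmorphB; apply/invertible_scalar_mx2/(qnil_invertible qa).
Qed.

Lemma scalM_central l N : GRing.comm N (scalM l).
Proof.
rewrite /GRing.comm /= (mx2E N) scalar_mx2 !mx2_mul !mulr0 !mul0r !addr0 !add0r.
by rewrite -!scalerAl -!scalerAr !mul1r !mulr1.
Qed.

(** The matrix is a root of [X^2 - X - c], which splits as [(X - (1 - t)) (X - t)]. *)
Lemma gHirano_companion c t : qnil scal t -> GRing.comm t c ->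
  t * t - t = c -> gHirano (@scalM2 K A) (mx2 1 1 c 0).
Proof.
move=> qt tc ttc; apply: (@gHirano_of_qnil_root _ _ scalM scalM_central _ t%:M).
- exact: qnil_scalar_mx2.
- rewrite /GRing.comm scalar_mx2 !mx2_mul.
  by rewrite !(mulr0, mul0r, addr0, add0r, mul1r, mulr1) tc.
- rewrite scalar_mx2 one_mx2 !mx2_sub mx2_mul -ttc !subr0 !sub0r subKr.
  rewrite zero_mx2.
  have e : t * (1 - t) = - (t * t - t) by rewrite mulrBr mulr1 opprB.
  rewrite mul1r mulr1 mul1r subrr e addNr opprB mulr1.
  rewrite !mulrN mulrBr mulr1 !mulrBl !mul1r.
  by rewrite mulrBr mulrA addrC subrKA !subrr.
Qed.

Lemma companion_resolvent c l : invertible (scal (l ^+ 2 - l) - c) ->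
  invertible (scalM l - mx2 1 1 c 0).
Proof.
move=> ic; apply: (quadratic_resolvent scalM_central).
have -> : mx2 1 1 c 0 * mx2 1 1 c 0 - mx2 1 1 c 0 = c%:M.
  rewrite scalar_mx2 mx2_mul mx2_sub !(mulr0, mul1r, mulr1, mul0r, addr0, subr0).
  by rewrite !subrr addrC addKr.
by rewrite /= -rmorphB; apply/invertible_scalar_mx2.
Qed.

(** The upper right entry of [scalM l - mx2 1 1 c 0] is -1, and its Schur complement is
    [l (l - 1) - c]. The inverse of that complement is the upper right entry [y] of the inverse
    matrix. *)
Lemma companion_schur c l : invertible (scalM l - mx2 1 1 c 0) ->
  invertible (scal (l ^+ 2 - l) - c).
Proof.
have -> : scalM l - mx2 1 1 c 0 = mx2 (l%:A - 1) (- 1) (- c) l%:A.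
  by rewrite scalM_mx2 mx2_sub !sub0r subr0.
move=> [N]; rewrite (mx2E N) one_mx2 !mx2_mul.
move: (N 0 0) (N 0 1) (N 1 0) (N 1 1) => x y z w.
move=> [/mx2_inj[_ e01 _ e11] /mx2_inj[f00 f01 _ _]].
have lc : scal (l ^+ 2 - l) - c = l%:A * (l%:A - 1) - c.
  by rewrite rmorphB rmorphXn /= mulrBr mulr1 expr2.
have wE : w = (l%:A - 1) * y.
  by apply/eqP; rewrite eq_sym -subr_eq0 -e01 mulN1r.
have xE : x = y * l%:A.
  by apply/eqP; rewrite -subr_eq0 -oppr_eq0 opprB -f01 mulrN1 addrC.
exists y; rewrite lc; split.
  by rewrite mulrBl -mulrA -wE addrC -mulNr.
by rewrite mulrBr mulrA -xE -mulrN.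
Qed.

Lemma qnil_of_gHirano_companion c :
  gHirano (@scalM2 K A) (mx2 1 1 c 0) -> qnil scal c.
Proof.
move=> gM; have [x [xMx [Mx qq]]] := gM.
have ic m : m != 0 -> invertible (scal m - c).
  move=> m0.
  have key l : l ^+ 2 - l = m -> l != -1 -> invertible (scal m - c).
    move=> lm lN1; rewrite -lm; apply: companion_schur.
    apply: (gHirano_resolvent scalM_central xMx Mx qq) => //.
      by apply: contraNneq m0 => l0; rewrite -lm l0 expr0n subrr.
    by apply: contraNneq m0 => l1; rewrite -lm l1 expr1n subrr.
  (* The roots of [l ^+ 2 - l = m] are [l] and [1 - l]. If the first is -1, the second is 2. *)
  pose r := sqrtC (1 + 4 * m); pose l := (1 + r) / 2.
  have lm : l ^+ 2 - l = m.
    have rr : r * r = 1 + 4 * m by rewrite -expr2 sqrtCK.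
    have -> : l ^+ 2 - l = (r * r - 1) / 4 by rewrite /l; field.
    by rewrite rr addrAC subrr add0r mulrC mulKf// pnatr_eq0.
  have [lN1|] := eqVneq l (-1); last exact: key.
  apply: (key (1 - l)).
    by rewrite -lm; ring.
  by rewrite lN1 -subr_eq0 (_ : _ - _ = 3) ?pnatr_eq0//; ring.
(* If [c] were invertible too, its spectrum would be empty, and so would that of the matrix. *)
apply: qnilP => [ic0|]; last exact: ic.
apply: (gHirano_exists_spectrum (f := scalM) gM) => l.
apply: companion_resolvent; have [->|] := eqVneq (l ^+ 2 - l) 0; last exact: ic.
by rewrite rmorph0 sub0r; apply: invertibleN.
Qed.
End TwoByTwo.

(** * Bounds on the resolvent *)

Section DiscCompactness.
Variable R : realType.
Local Open Scope complex_scope.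
Local Open Scope classical_set_scope.
Implicit Types (x y r : R) (z : R[i]).

Lemma normc_ge0 z : 0 <= Normc.normc z.
Proof. by case: z => x y; exact: sqrtr_ge0. Qed.

Lemma normc_real x : Normc.normc x%:C = `|x|.
Proof. by rewrite /= expr0n addr0 sqrtr_sqr. Qed.

Lemma normc_le_box x y : Normc.normc (x +i* y) <= `|x| + `|y|.
Proof.
rewrite /= -[leRHS]ger0_norm ?addr_ge0// -sqrtr_sqr ler_wsqrtr// sqrrD.
by rewrite !real_normK ?num_real// [leRHS]addrAC lerDl mulrn_wge0// mulr_ge0.
Qed.

Lemma box_le_normc x y :
  `|x| <= Normc.normc (x +i* y) /\ `|y| <= Normc.normc (x +i* y).
Proof.
by rewrite -!sqrtr_sqr /= !ler_wsqrtr// ?lerDl ?lerDr sqr_ge0.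
Qed.

(** Compactness of a square containing the disc makes the local bounds uniform. The near-covering
    form is applied with the bound itself, tending to infinity, as parameter. *)
Lemma locally_bounded_disc (g : R[i] -> R) (r : R) :
  (forall w, exists d b, 0 < d /\ forall z, Normc.normc (z - w) < d -> g z <= b) ->
  exists b, forall z, Normc.normc z <= r -> g z <= b.
Proof.
move=> gb; pose box : set (R * R) := `[- r, r] `*` `[- r, r].
have /compact_near_coveringP : compact box.
  by apply: compact_setX; exact: segment_compact.
move=> /(_ R (pinfty_nbhs R) (fun b p => g (p.1 +i* p.2) <= b) _).
case=> [[u v] _ /=|B [_ hB]].
  have [d [b [d0 db]]] := gb (u +i* v).
  (* Half of [d], because product balls are squares and the modulus is estimated by the sum of the
     two coordinates. *)
  exists (ball (u, v) (d / 2), [set b' | b <= b']).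
    split; first by apply: nbhsx_ballx; rewrite divr_gt0.
    exact: nbhs_pinfty_ge (num_real b).
  move=> [[x y] b'] /= [[xu yv] bb']; apply: le_trans bb'; apply: db.
  apply: le_lt_trans (normc_le_box _ _) _.
  have := ltrD xu yv; rewrite -splitr.
  by rewrite /= (distrC x) (distrC y).
exists (B + 1) => -[x y] xyr.
have [xn yn] := box_le_normc x y.
apply: (hB (B + 1) _ (x, y)); first by rewrite ltrDl.
by split; rewrite /= in_itv/= -ler_norml; apply: le_trans xyr.
Qed.
End DiscCompactness.

Section BanachAlgebra.
Variables (R : realType) (A : algType R[i]) (N : A -> R).
Hypothesis hN : is_banach_algebra_norm N.
Local Open Scope complex_scope.
Implicit Types (a b c x y : A) (z w : R[i]) (r s : R).

Lemma nrm_eq0 x : N x = 0 -> x = 0. Proof. by case: hN => + _ _ _ _; exact. Qed.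
Lemma nrmD x y : N (x + y) <= N x + N y. Proof. by case: hN. Qed.
Lemma nrmZ z x : N (z *: x) = Normc.normc z * N x. Proof. by case: hN. Qed.
Lemma nrmM x y : N (x * y) <= N x * N y. Proof. by case: hN. Qed.

Lemma nrm0 : N 0 = 0.
Proof. by rewrite -(scale0r 0) nrmZ Normc.normc0 mul0r. Qed.

Lemma nrmN x : N (- x) = N x.
Proof. by rewrite -scaleN1r nrmZ normcN Normc.normc1 mul1r. Qed.

Lemma nrmB x y : N (x - y) <= N x + N y.
Proof. by rewrite -(nrmN y); exact: nrmD. Qed.

Lemma nrm_ge0 x : 0 <= N x.
Proof. by have := nrmB x x; rewrite subrr nrm0 -mulr2n pmulrn_lge0. Qed.

Lemma nrm1_gt0 : 0 < N 1.
Proof.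
rewrite lt_def nrm_ge0 andbT; apply/eqP => /nrm_eq0/eqP.
by rewrite oner_eq0.
Qed.

Lemma nrmM_le x y r s : N x <= r -> N y <= s -> N (x * y) <= r * s.
Proof.
move=> xr ys; apply: le_trans (nrmM _ _) _.
exact: ler_pM (nrm_ge0 _) (nrm_ge0 _) xr ys.
Qed.

Lemma nrmD_le x y r s : N x <= r -> N y <= s -> N (x + y) <= r + s.
Proof. by move=> xr ys; apply: le_trans (nrmD _ _) _; exact: lerD. Qed.

Definition inverse a b := a * b = 1 /\ b * a = 1.

Lemma inverse_uniq a x y : inverse a x -> inverse a y -> x = y.
Proof. by move=> [_ xa] [ay _]; rewrite -[x]mulr1 -ay mulrA xa mul1r. Qed.

Lemma one_subBB x y : (1 - x) - (1 - y) = y - x.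
Proof. by rewrite opprB addrC addrA subrK. Qed.

Lemma inverse_sub a b x y : inverse a x -> inverse b y ->
  x - y = x * (b - a) * y.
Proof.
move=> [_ xa] [b_y _].
by rewrite mulrBr mulrBl xa mul1r -mulrA b_y mulr1.
Qed.

(** * Spectral radius of an element with entire resolvent *)

Section EntireResolvent.
Variable c : A.
Hypothesis inv_c : forall z, invertible (1 - z *: c).

(** The resolvent identity gives [N (F z) <= 2 * N (F w)] for [z] close to [w]; local bounds become
    a bound on the disc by compactness. *)
Lemma resolvent_bound r : exists2 b, 0 <= b &
  forall z y, Normc.normc z <= r -> inverse (1 - z *: c) y -> N y <= b.
Proof.
have [F hF] : {F : R[i] -> A & forall z, inverse (1 - z *: c) (F z)}.
  exact: (choice inv_c).
have [|b hb] := @locally_bounded_disc _ (N \o F) r.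
  (* For this radius [F z - F w = (z - w) F z c F w] has norm at most half of [N (F z)]. *)
  move=> w; exists (2 * (N c * N (F w) + 1))^-1, (2 * N (F w)).
  have k0 : 0 < N c * N (F w) + 1 by rewrite ltr_wpDl// mulr_ge0 ?nrm_ge0.
  split; first by rewrite invr_gt0 mulr_gt0.
  move=> z zw; have := inverse_sub (hF z) (hF w).
  rewrite one_subBB -scalerBl => e.
  have : N (F z - F w) <= 2^-1 * N (F z).
    rewrite e -scalerAr -scalerAl nrmZ.
    have h1 : N (F z * c * F w) <= N (F z) * N c * N (F w).
      by apply: nrmM_le => //; exact: nrmM.
    apply: (@le_trans _ _
      ((2 * (N c * N (F w) + 1))^-1 * (N (F z) * N c * N (F w)))).
      by apply: ler_pM => //; [exact: normc_ge0|exact: nrm_ge0|exact: ltW].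
    rewrite invfM -!mulrA ler_pM2l ?invr_gt0 ?ltr0n//.
    rewrite mulrCA ler_piMr ?nrm_ge0//.
    by rewrite ler_pdivrMl// mulr1 lerDl.
  have := nrmD (F z - F w) (F w); rewrite subrK /=.
  lra.
exists (Num.max b 0); first by rewrite le_max lexx orbT.
move=> z y zr zy; rewrite (inverse_uniq zy (hF z)) le_max.
by rewrite [N _ <= b]hb.
Qed.

Lemma root_of_N1 k : exists2 e : R[i], Normc.normc e = 1 & e ^+ (2 ^ k) = -1.
Proof.
elim: k => [|k [e e1 ek]].
  by exists (-1); rewrite ?expr1// normcN Normc.normc1.
exists (sqrtC e); last by rewrite expnS exprM sqrtCK.
have : Normc.normc (sqrtC e) ^+ 2 = 1 by rewrite expr2 -Normc.normcM -expr2 sqrtCK.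
by move=> /eqP; rewrite sqrp_eq1 ?normc_ge0// => /eqP.
Qed.

Lemma expN_pow2 k (e : R[i]) a : e ^+ (2 ^ k) = -1 ->
  (e *: a) ^+ (2 ^ k) = - a ^+ (2 ^ k).
Proof. by move=> ek; rewrite exprZn ek scaleN1r. Qed.

(** Partial fractions for [1 / (1 - x^2)]. Iterated, this gives the mean over the roots of unity of
    order [2 ^ k], two terms at a time. *)
Lemma inverse_one_sub_sqr x a b : inverse (1 - x) a -> inverse (1 + x) b ->
  inverse (1 - x ^+ 2) (2^-1 *: (a + b)).
Proof.
move=> [xa ax] [xb bx].
have xx : 1 - x ^+ 2 = (1 - x) * (1 + x).
  by rewrite mulrDr mulr1 mulrBl mul1r expr2 addrA subrK.
have xx' : 1 - x ^+ 2 = (1 + x) * (1 - x).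
  by rewrite mulrBr mulr1 mulrDl mul1r expr2 opprD addrA addrK.
have half : 2^-1 *: (1 - x + (1 + x)) = 1.
  rewrite addrACA addNr addr0 (_ : 1 + 1 = (2 : R[i]) *: 1).
    by rewrite scalerA mulVf ?scale1r ?pnatr_eq0.
  exact/esym/scaler_nat.
split; rewrite -?scalerAr -?scalerAl -[RHS]half; congr (_ *: _).
  rewrite mulrDr {1}xx' xx -!mulrA xa xb !mulr1; exact: addrC.
rewrite mulrDl {1}xx xx' !mulrA ax bx !mul1r; exact: addrC.
Qed.

Lemma inverse_pow2 k z : exists y, inverse (1 - (z *: c) ^+ (2 ^ k)) y.
Proof.
elim: k z => [|k IH] z; first by rewrite expr1; exact: inv_c.
have [e _ ek] := root_of_N1 k.
have [a ha] := IH z; have [b hb] := IH (e * z).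
rewrite -scalerA (expN_pow2 _ ek) opprK in hb.
by exists (2^-1 *: (a + b)); rewrite expnSr exprM; exact: inverse_one_sub_sqr.
Qed.

(** [L] does not depend on [k]: the resolvent identity gives it for [k = 0], and the induction step
    averages the inverses for the directions [u] and [e * u], which keeps the constant. Hence the
    quantification over all [u] of modulus 1. *)
Lemma resolvent_pow2_lipschitz r : 0 <= r -> exists2 L, 0 <= L &
  forall k s t u x y, 0 <= s <= r -> 0 <= t <= r -> Normc.normc u = 1 ->
    inverse (1 - ((s%:C * u) *: c) ^+ (2 ^ k)) x ->
    inverse (1 - ((t%:C * u) *: c) ^+ (2 ^ k)) y ->
    N (x - y) <= L * `|s - t|.
Proof.
move=> r0; have [B B0 hB] := resolvent_bound r.
exists (B * N c * B); first by rewrite !mulr_ge0 ?nrm_ge0.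
have inr s u : 0 <= s <= r -> Normc.normc u = 1 -> Normc.normc (s%:C * u) <= r.
  by move=> /andP[s0 sr] u1; rewrite Normc.normcM normc_real u1 mulr1 ger0_norm.
elim=> [|k IH] s t u x y hs ht u1.
  rewrite !expr1 => hx hy; rewrite (inverse_sub hx hy) one_subBB.
  rewrite -scalerBl -mulrBl -rmorphB -scalerAr -scalerAl nrmZ.
  rewrite Normc.normcM normc_real u1 mulr1 mulrC ler_wpM2r//.
  apply: nrmM_le; last by apply: hB hy; exact: inr.
  by apply: nrmM_le => //; apply: hB hx; exact: inr.
rewrite expnSr !exprM => hx hy.
have [e e1 ek] := root_of_N1 k.
have [a ha] := inverse_pow2 k (s%:C * u).
have [b hb] := inverse_pow2 k (s%:C * (e * u)).
have [a' ha'] := inverse_pow2 k (t%:C * u).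
have [b' hb'] := inverse_pow2 k (t%:C * (e * u)).
have eu1 : Normc.normc (e * u) = 1 by rewrite Normc.normcM e1 u1 mulr1.
have la := IH _ _ _ _ _ hs ht u1 ha ha'.
have lb := IH _ _ _ _ _ hs ht eu1 hb hb'.
have flip v : 1 - ((v * (e * u)) *: c) ^+ (2 ^ k) = 1 + ((v * u) *: c) ^+ (2 ^ k).
  by rewrite mulrCA -(scalerA e) (expN_pow2 _ ek) opprK.
rewrite !flip in hb hb'.
rewrite (inverse_uniq hx (inverse_one_sub_sqr ha hb)).
rewrite (inverse_uniq hy (inverse_one_sub_sqr ha' hb')).
rewrite -scalerBr nrmZ opprD addrACA Normc.normcV.
have -> : Normc.normc (2 : R[i]) = 2.
  by rewrite -[2]/(2%:R) -(rmorph_nat (real_complex R)) normc_real ger0_norm.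
rewrite ler_pdivrMl// mulr2n mulrDl mul1r.
exact: nrmD_le.
Qed.

Lemma half_expn_small (e : R) : 0 < e -> exists n, 2^-1 ^+ n <= e.
Proof.
move=> e0; have ei : 0 <= e^-1 by rewrite invr_ge0 ltW.
exists (Num.bound e^-1); have := archi_boundP ei.
move: (Num.bound _) => n hn.
rewrite exprVn invf_ple ?posrE ?exprn_gt0//; apply: le_trans (ltW hn) _.
by rewrite -natrX ler_nat ltnW// ltn_expl.
Qed.

Lemma nrm_pow2_small x (e : R) : N x <= 2^-1 -> 0 < e ->
  exists j, N (x ^+ (2 ^ j)) <= e.
Proof.
move=> x2 /half_expn_small[n hn]; exists n; apply: le_trans hn.
(* The exponent [n.+1] carries the induction: squaring doubles it to at least [n.+2]. *)
have {}hn : N (x ^+ (2 ^ n)) <= 2^-1 ^+ n.+1.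
  elim: n => [|n IH]; first by rewrite !expr1.
  rewrite expnSr exprM expr2; apply: le_trans (nrmM_le IH IH) _.
  by rewrite -exprD ler_wiXn2l ?invr_ge0 ?invf_le1 ?ler1n// addSnnS leq_addl.
by apply: le_trans hn _; rewrite ler_wiXn2l ?invr_ge0 ?invf_le1 ?ler1n.
Qed.

(** Here and in the next lemma [x * y = y - 1], so [x] and [y - 1] differ by [x * (y - 1)], which is
    absorbed when either is small. *)
Lemma small_of_inverse_near_one x y : inverse (1 - x) y -> N (y - 1) <= 4^-1 ->
  N x <= 2^-1.
Proof.
move=> [xy _] y4.
have xE : x = (y - 1) - x * (y - 1).
  have xyE : x * y = y - 1 by rewrite -xy mulrBl mul1r subKr.
  by rewrite mulrBr mulr1 xyE subKr.
have : N (x * (y - 1)) <= N x * 4^-1 by exact: nrmM_le.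
have := nrmB (y - 1) (x * (y - 1)); rewrite -xE.
lra.
Qed.

Lemma inverse_near_one x y : inverse (1 - x) y -> N x <= 2^-1 ->
  N (y - 1) <= 2 * N 1 * N x.
Proof.
move=> [xy _] x2; have xyE : y - 1 = x * (y - 1) + x.
  by rewrite mulrBr mulr1 subrK -{1}xy mulrBl mul1r subKr.
have : N (y - 1) <= N x * N (y - 1) + N x.
  by rewrite {1}xyE; apply: nrmD_le => //; exact: nrmM.
have := nrmM 1 x; rewrite mul1r.
have : N x * N (y - 1) <= 2^-1 * N (y - 1) by rewrite ler_wpM2r ?nrm_ge0.
lra.
Qed.

(** This amounts to the spectral radius of [s c] being less than 1. *)
Definition contractive_at s := exists k, N ((s%:C *: c) ^+ (2 ^ k)) <= 2^-1.

(** After raising the power, the inverse at [s] is within 1/8 of 1. The Lipschitz bound puts the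
    inverse at [t] within another 1/8, and closeness 1/4 to 1 makes the power at [t] small. As [L]
    is uniform in [k], [d] depends on [r] alone. *)
Lemma contractive_at_step r : 0 <= r -> exists2 d, 0 < d &
  forall s t, 0 <= s <= r -> 0 <= t <= r -> `|s - t| <= d ->
    contractive_at s -> contractive_at t.
Proof.
move=> r0; have [L L0 hL] := resolvent_pow2_lipschitz r0.
exists (8 * (L + 1))^-1; first by rewrite invr_gt0 mulr_gt0// ltr_wpDl.
move=> s t hs ht st [k hk].
(* The bound 1/2 is the hypothesis of [inverse_near_one]; the other makes its conclusion
   [2 * N 1 * e] at most 1/8. *)
pose e := Num.min 2^-1 (16 * N 1)^-1 : R.
have e0 : 0 < e by rewrite lt_min !invr_gt0 mulr_gt0 ?nrm1_gt0 ?ltr0n.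
have [j] := nrm_pow2_small hk e0; rewrite -exprM -expnD => hj.
exists (k + j)%N; move: (k + j)%N hj => {hk}k hk.
have [x hx] := inverse_pow2 k (s%:C * 1).
have [y hy] := inverse_pow2 k (t%:C * 1).
have := hL _ _ _ _ _ _ hs ht (Normc.normc1 R) hx hy.
rewrite !mulr1 in hx hy *.
have {}st : L * `|s - t| <= 8^-1.
  apply: le_trans (ler_wpM2l L0 st) _.
  rewrite invfM mulrCA ler_piMr ?invr_ge0//.
  by rewrite ler_pdivrMr ?ltr_wpDl// mul1r lerDl.
have {hx} := inverse_near_one hx.
move: hk; rewrite /e le_min => /andP[-> /= h16] /(_ isT) x1 xy.
apply: (small_of_inverse_near_one hy).
have {}x1 : N (x - 1) <= 8^-1.
  apply: le_trans x1 _.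
  have := ler_wpM2l (ltW nrm1_gt0) h16.
  rewrite invfM mulrCA mulfV ?gt_eqF ?nrm1_gt0//.
  lra.
have := nrmB (x - 1) (x - y); rewrite opprB addrC subrKA.
lra.
Qed.

Lemma contractive_everywhere r : 0 <= r -> contractive_at r.
Proof.
move=> r0; have [d d0 hd] := contractive_at_step r0.
(* From 0 to [r] in [n] equal steps, each of length at most [d]. *)
pose n := Num.bound (r / d).
have rn : r / d < n%:R by apply: archi_boundP; rewrite divr_ge0// ltW.
have n0 : 0 < n%:R :> R by apply: le_lt_trans rn; rewrite divr_ge0// ltW.
have P i : (i <= n)%N -> 0 <= i%:R * (r / n%:R) <= r.
  move=> ni; rewrite mulr_ge0 ?divr_ge0//= mulrCA ler_piMr//.
  by rewrite ler_pdivrMr// mul1r ler_nat.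
suff H i : (i <= n)%N -> contractive_at (i%:R * (r / n%:R)).
  by have := H n (leqnn n); rewrite mulrC divfK// gt_eqF.
elim: i => [|i IH] ni.
  exists 0%N; rewrite mul0r rmorph0 scale0r expr1 nrm0; lra.
apply: hd (IH (ltnW ni)); [exact/P/ltnW|exact: P|].
rewrite distrC -mulrBl -natr1 addrAC subrr add0r mul1r ger0_norm ?divr_ge0//.
by rewrite ler_pdivrMr// mulrC -ler_pdivrMr// ltW.
Qed.
End EntireResolvent.

(** * Limits in the algebra *)

Lemma half_expn_ge0 n : 0 <= 2^-1 ^+ n :> R.
Proof. by rewrite exprn_ge0// invr_ge0. Qed.

Lemma geometric_cauchy (u : nat -> A) (k : R) :
  (forall n, N (u n.+1 - u n) <= k * 2^-1 ^+ n) ->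
  exists l, converges_to N u l.
Proof.
move=> hu; case: hN => _ _ _ _; apply.
have k0 : 0 <= k by have := hu 0%N; rewrite expr0 mulr1; apply: le_trans (nrm_ge0 _).
(* The exact geometric sum, with its subtracted tail, makes the induction on [j] close. *)
have far m j : N (u (m + j)%N - u m) <= 2 * k * (2^-1 ^+ m - 2^-1 ^+ (m + j)).
  elim: j => [|j IH]; first by rewrite addn0 !subrr nrm0 mulr0.
  have := nrmD (u (m + j).+1 - u (m + j)%N) (u (m + j)%N - u m).
  rewrite addrA subrK addnS exprS; have := hu (m + j)%N.
  move: (2^-1 ^+ (m + j)) (2^-1 ^+ m) IH => p q; lra.
move=> e e0; have k1 : 0 < 8 * (k + 1) by rewrite mulr_gt0// ltr_wpDl.
have [M hM] := half_expn_small (divr_gt0 e0 k1); exists M.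
have near n : (M <= n)%N -> N (u n - u M) <= e / 4.
  move=> /subnKC <-; apply: le_trans (far _ _) _.
  rewrite ler_pdivlMr// in hM.
  have : 0 <= k * 2^-1 ^+ (M + (n - M)) by rewrite mulr_ge0// half_expn_ge0.
  have := half_expn_ge0 M.
  move: hM; move: (2^-1 ^+ M) (2^-1 ^+ (M + (n - M))) => p q; lra.
move=> m n /near hm /near hn.
have := nrmB (u m - u M) (u n - u M); rewrite opprB addrA subrK.
lra.
Qed.

Lemma nrm_small_eq0 x (k : R) :
  (forall e, 0 < e -> e <= 1 -> N x <= k * e) -> x = 0.
Proof.
move=> hx; apply: nrm_eq0; apply/eqP; rewrite eq_le nrm_ge0 andbT.
have k0 : 0 <= k.
  have := hx 1 ltr01 (lexx _); rewrite mulr1; exact: le_trans (nrm_ge0 _).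
apply/ler_addgt0Pr => e e0; rewrite add0r.
have k1 : 0 < k + 1 by rewrite ltr_wpDl.
have m0 : 0 < Num.min 1 (e / (k + 1)) by rewrite lt_min ltr01 divr_gt0.
have := hx _ m0; rewrite ge_min lexx => /(_ isT) /le_trans; apply.
apply: (@le_trans _ _ (k * (e / (k + 1)))).
  by rewrite ler_wpM2l// ge_min lexx orbT.
rewrite mulrCA ler_piMr ?(ltW e0)//.
by rewrite ler_pdivrMr// mul1r lerDl.
Qed.

(** * A quasinilpotent root of t^2 - t = c *)

Section CatalanRoot.
Variables (c : A) (n : nat).
Hypothesis n_gt0 : (0 < n)%N.
Let d := (8 : R)%:C *: c.
Hypothesis dn : N (d ^+ n) <= 1.

(* An equivalent norm for which multiplication by c has operator norm at
   most 1/8. *)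
Let M x := \sum_(i < n) N (d ^+ i * x).
Let op_le y (k : R) := forall x, M (y * x) <= k * M x.

Let M_ge0 x : 0 <= M x.
Proof. by apply: sumr_ge0 => i _; exact: nrm_ge0. Qed.

Let N_le_M x : N x <= M x.
Proof.
rewrite /M; case: (n) n_gt0 => // m _; rewrite big_ord_recl mul1r lerDl.
by apply: sumr_ge0 => i _; exact: nrm_ge0.
Qed.

Let MD x y : M (x + y) <= M x + M y.
Proof. by rewrite /M -big_split /=; apply: ler_sum => i _; rewrite mulrDr nrmD. Qed.

Let MN x : M (- x) = M x.
Proof. by apply: eq_bigr => i _; rewrite mulrN nrmN. Qed.

Let op_leD x y (k l : R) : op_le x k -> op_le y l -> op_le (x + y) (k + l).
Proof.
move=> xk yl v; rewrite !mulrDl; apply: le_trans (MD _ _) _; exact: lerD.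
Qed.

Let op_leN y (k : R) : op_le y k -> op_le (- y) k.
Proof. by move=> yk x; rewrite mulNr MN. Qed.

Let op_leM x y (k l : R) : 0 <= k -> op_le x k -> op_le y l -> op_le (x * y) (k * l).
Proof.
move=> k0 xk yl v; rewrite -!mulrA; apply: le_trans (xk _) _.
exact: ler_wpM2l.
Qed.

Let op_leW y (k l : R) : k <= l -> op_le y k -> op_le y l.
Proof. by move=> kl yk x; apply: le_trans (yk _) _; rewrite ler_wpM2r. Qed.

Let op_le1 : op_le 1 1.
Proof. by move=> x; rewrite !mul1r. Qed.

(** Multiplying by [d] shifts the sum [M]: the term [N x] is replaced by [N (d ^+ n * x)], which is
    no larger. *)
Let op_lec : op_le c 8^-1.
Proof.
have Md x : M (d * x) <= M x.
  have e : M (d * x) + N x = M x + N (d ^+ n * x).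
    transitivity (\sum_(i < n.+1) N (d ^+ i * x)); last by rewrite big_ord_recr.
    rewrite big_ord_recl expr0 mul1r addrC; congr (_ + _).
    by apply: eq_bigr => i _; rewrite exprSr mulrA.
  have : N (d ^+ n * x) <= 1 * N x by exact: nrmM_le.
  have := e; lra.
have Mr x : M ((8 : R)%:C *: x) = 8 * M x.
  rewrite /M mulr_sumr; apply: eq_bigr => i _.
  by rewrite -scalerAr nrmZ normc_real ger0_norm.
by move=> x; have := Md x; rewrite /d -scalerAl Mr; lra.
Qed.

(** Picard iteration for [y = 1 - c y^2]. With [c] of size 1/8 the operator bound 2 is preserved, as
    [1 + 4 / 8 <= 2], and increments shrink by the factor [(2 + 2) / 8 = 1 / 2]. *)
Let w i := iter i (fun y => 1 - c * (y * y)) 1.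

Let op_lew i : op_le (w i) 2.
Proof.
elim: i => [|i IH]; first by apply: op_leW op_le1; rewrite ler1n.
have h := op_leM _ op_lec (op_leM _ IH IH).
apply: op_leW (op_leD op_le1 (op_leN (h _ _))); rewrite ?invr_ge0//.
lra.
Qed.

Let sub_sqr x y : x * x - y * y = x * (x - y) + (x - y) * y.
Proof. by rewrite mulrBr mulrBl addrA subrK. Qed.

Let wS_sub i : op_le (w i.+1 - w i) (2^-1 ^+ i).
Proof.
elim: i => [|i IH].
  rewrite /= !mulr1 addrAC subrr add0r expr0; apply: op_leN.
  by apply: op_leW op_lec; lra.
have -> : w i.+2 - w i.+1 =
    - (c * (w i.+1 * (w i.+1 - w i) + (w i.+1 - w i) * w i)).
  by rewrite -sub_sqr mulrBr [RHS]opprB -[RHS]one_subBB.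
apply: op_leN; rewrite exprS.
have p0 := half_expn_ge0 i.
have h' := op_leD (op_leM _ (op_lew i.+1) IH) (op_leM p0 IH (op_lew i)).
have h := op_leM _ op_lec (h' _).
apply: op_leW (h _ _); rewrite ?invr_ge0//.
move: (2^-1 ^+ i) p0 => p p0; lra.
Qed.

(* The solution is the generating function of the Catalan numbers at -c, and
   t = - c y then satisfies t^2 - t = c. *)
Lemma catalan_root : exists y, y + c * (y * y) = 1 /\ GRing.comm y c.
Proof.
have [i|y hy] := @geometric_cauchy w (M 1).
  (* Applying the operator bound to the vector 1 brings it back to [N]. *)
  apply: le_trans (N_le_M _) _; rewrite -[X in M X]mulr1 mulrC.
  exact: wS_sub.
exists y; split.
  apply/eqP; rewrite -subr_eq0; apply/eqP.
  apply: (@nrm_small_eq0 _ (1 + N c * (2 * N y + 1))) => e e0 e1.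
  have [m hm] := hy e e0.
  have l0 := ltW (hm m (leqnn m)); have l1 := ltW (hm m.+1 (leqnSn m)).
  have wm : N (w m) <= N y + 1.
    rewrite -(subrK y (w m)) addrC; apply: nrmD_le => //; exact: le_trans l0 e1.
  have -> : y + c * (y * y) - 1 =
      - (w m.+1 - y) - c * (w m * (w m - y) + (w m - y) * y).
    rewrite -sub_sqr mulrBr /=; move: (c * (y * y)) (c * (w m * w m)) => p q.
    by rewrite !opprB [q - 1]addrC !addrA [RHS]addrAC addrK addrAC.
  have h1 : N (w m * (w m - y) + (w m - y) * y) <= (N y + 1) * e + e * N y.
    by apply: nrmD_le; apply: nrmM_le.
  apply: le_trans (nrmB _ _) _; rewrite nrmN.
  have := nrmM_le (lexx (N c)) h1; lra.
have wc i : GRing.comm c (w i).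
  elim: i => [|i IH]; first exact: commr1.
  by apply: commrB; [exact: commr1|]; do 2?apply: commrM.
apply/eqP; rewrite -subr_eq0; apply/eqP.
apply: (@nrm_small_eq0 _ (2 * N c)) => e e0 _.
have [m hm] := hy e e0; have l0 := ltW (hm m (leqnn m)).
have -> : y * c - c * y = c * (w m - y) - (w m - y) * c.
  by rewrite mulrBr mulrBl -(wc m) opprB [RHS]addrC subrKA.
apply: le_trans (nrmB _ _) _.
have := nrmM_le (lexx (N c)) l0; have := nrmM_le l0 (lexx (N c)).
lra.
Qed.
End CatalanRoot.

Lemma qnil_catalan_root c : qnil (@scalA R[i] A) c ->
  exists t, [/\ t * t - t = c, GRing.comm t c & qnil (@scalA R[i] A) t].
Proof.
move=> qc.
pose f : {rmorphism R[i] -> A} := in_alg A.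
have qf : qnil f c by [].
have ic z : invertible (1 - z *: c).
  have [->|z0] := eqVneq z 0.
    by rewrite scale0r subr0; exists 1; rewrite mulr1.
  have -> : 1 - z *: c = f z * (f z^-1 - c).
    by rewrite mulrBr -rmorphM mulfV// rmorph1 /= mulr_algl.
  apply: invertibleM; first exact: invertible_scal.
  by apply: (qnil_invertible qf); rewrite invr_eq0.
have [k hk] := contractive_everywhere ic (ler0n R 8).
have [||w [wE wc]] := @catalan_root c (2 ^ k).
- by rewrite expn_gt0.
- by apply: le_trans hk _; lra.
pose t := - (c * w).
have tt : t * t - t = c.
  rewrite /t mulrNN opprK -mulrA (mulrA w) wc -(mulrA c w) -mulrDr addrC wE.
  exact: mulr1.
have tc : GRing.comm t c.
  by apply/commr_sym; rewrite /t -mulrN; apply: commrM => //; exact/commrN/commr_sym.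
have fC l (x : A) : GRing.comm x (f l).
  by rewrite /GRing.comm /= -scalerAr -scalerAl mulr1 mul1r.
exists t; split=> //; apply: (@qnilP _ _ f) => [|l l0].
  rewrite /t -mulrN => /(invertible_comm_factor _) H.
  apply: (qnil_noninvertible qf); apply: H.
  exact/commrN/commr_sym.
(* At [l = 1] the scalar [l ^+ 2 - l] vanishes and the factorization says nothing, but
   [1 - t = 1 + c * w] has inverse [w] by the equation for [w]. *)
have [->|l1] := eqVneq l 1.
  rewrite rmorph1 /t opprK; exists w; split.
    by rewrite mulrDl mul1r -mulrA.
  by rewrite mulrDr mulr1 mulrA wc -mulrA.
apply: (quadratic_resolvent fC); rewrite tt; apply: (qnil_invertible qf).
by rewrite expr2 -{3}[l]mulr1 -mulrBr mulf_neq0// subr_eq0.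
Qed.
End BanachAlgebra.

Unset Implicit Arguments.

Theorem theorem4p1 (R : realType) (A : algType R[i]) (nrm : A -> R)
    (hA : is_banach_algebra_norm nrm) (c : A) :
  qnil (@scalA R[i] A) c <->
  gHirano (@scalM2 R[i] A) (mx2 (1 : A) 1 c 0).
Proof.
split=> [/(qnil_catalan_root hA)[t [ttc tc qt]]|].
  exact: gHirano_companion qt tc ttc.
exact: qnil_of_gHirano_companion.
Qed.
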